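(* Let $p>0$. The index $S_p$ has the Robin Hood property: for every vector $Y=(Y_1,\dots,Y_N)$ with positive entries and every pair of indices $i,j$ with $Y_i<Y_j$, there exists $\bar\varepsilon>0$ such that for every $0\le\varepsilon\le\bar\varepsilon$ the vector $Y_\varepsilon$ defined by $$(Y_\varepsilon)_i=Y_i+\varepsilon,\qquad (Y_\varepsilon)_j=Y_j-\varepsilon,\qquad (Y_\varepsilon)_k=Y_k\ \text{ for }k\notin\{i,j\}$$ satisfies $S_p(Y_\varepsilon)\le S_p(Y)$.
   Context: For a vector $Y=(Y_1,\dots,Y_N)$ with positive entries, let $r$ be a permutation of $\{1,\dots,N\}$ with $Y_{r_1}\le Y_{r_2}\le\dots\le Y_{r_N}$, and let $\bar Y=\frac1N\sum_{i=1}^N Y_i$. The Lorenz curve $L_Y:[0,1]\to\mathbb{R}$ is the piecewise linear interpolation of the points $\big(\frac kN,\sum_{i=1}^kY_{r_i}\big)$, $k=0,\dots,N$, and the dual Lorenz curve $L_Y^c:[0,1]\to\mathbb{R}$ is the piecewise linear interpolation of the points $\big(\frac kN,\sum_{i=1}^kY_{r_{N+1-i}}\big)$, $k=0,\dots,N$. For $p>0$, $$S_p(Y)=\frac{1}{N\bar Y}\Big(\int_0^1|L_Y^c(t)-L_Y(t)|^p\,dt\Big)^{1/p}.$$ *)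

(* Defs.v *)
From HB Require Import structures.
From mathcomp Require Import all_boot all_order all_algebra all_fingroup.
From mathcomp Require Import all_classical all_reals all_analysis.

Set Implicit Arguments.
Unset Strict Implicit.
Unset Printing Implicit Defensive.
Import Order.TTheory GRing.Theory Num.Theory.
Import numFieldNormedType.Exports.
Local Open Scope classical_set_scope.
Local Open Scope ring_scope.

Definition sorts (R : realType) (N : nat) (Y : 'rV[R]_N) (r : 'S_N) : bool :=
  [forall i : 'I_N, forall j : 'I_N,
    (i <= j)%N ==> (Y ord0 (r i) <= Y ord0 (r j))].

(* The default value 1 is never used ([sorting_permP]), and the sorted vector
   does not depend on which sorting permutation is picked ([sorts_eq]). *)
Definition sorting_perm (R : realType) (N : nat) (Y : 'rV[R]_N) : 'S_N :=
  odflt 1%g [pick r : 'S_N | sorts Y r].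

(* Piecewise linear interpolation on [0, 1] of the points (k / N, a k),
   k = 0, ..., N: on [k / N, (k + 1) / N] it is the affine function joining two
   consecutive points ([pl_interpE]). Values outside [0, 1] are irrelevant; at
   t = 1 the slope term is multiplied by 0, so a N.+1 plays no role. *)
Definition pl_interp (R : realType) (N : nat) (a : nat -> R) (t : R) : R :=
  let k := Num.truncn (N%:R * t) in
  a k + (N%:R * t - k%:R) * (a k.+1 - a k).

Definition lorenz (R : realType) (N : nat) (Y : 'rV[R]_N) : R -> R :=
  pl_interp N (fun k => \sum_(i < N | (i < k)%N) Y ord0 (sorting_perm Y i)).

(* With indices starting at 0, r_{N+1-i} becomes r (N-1-i) = r (rev_ord i). *)
Definition dual_lorenz (R : realType) (N : nat) (Y : 'rV[R]_N) : R -> R :=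
  pl_interp N
    (fun k => \sum_(i < N | (i < k)%N) Y ord0 (sorting_perm Y (rev_ord i))).

Definition mean (R : realType) (N : nat) (Y : 'rV[R]_N) : R :=
  N%:R^-1 * \sum_(i < N) Y ord0 i.

Definition S_index (R : realType) (p : R) (N : nat) (Y : 'rV[R]_N) : R :=
  (N%:R * mean Y)^-1 *
  (\int[@lebesgue_measure R]_(t in `[0, 1])
     (`|dual_lorenz Y t - lorenz Y t| `^ p)) `^ p^-1.

Definition transfer (R : realType) (N : nat) (i j : 'I_N) (e : R)
    (Y : 'rV[R]_N) : 'rV[R]_N :=
  \row_(k < N) (if k == i then Y ord0 i + e
                else if k == j then Y ord0 j - e
                else Y ord0 k).

Lemma sortsP (R : realType) (N : nat) (Y : 'rV[R]_N) (r : 'S_N) :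
  reflect (forall i j : 'I_N, (i <= j)%N -> Y ord0 (r i) <= Y ord0 (r j))
          (sorts Y r).
Proof.
apply: (iffP forallP) => [H i j ij|H i].
  by have /forallP/(_ j)/implyP/(_ ij) := H i.
by apply/forallP => j; apply/implyP => ij; exact: H.
Qed.

Lemma sorts_ex (R : realType) (N : nat) (Y : 'rV[R]_N) :
  exists r : 'S_N, sorts Y r.
Proof.
pose t := [tuple Y ord0 i | i < N].
have /tuple_permP[r Er] : perm_eq (sort <=%O t) t by rewrite perm_sort.
exists r; apply/sortsP => i j ij.
have := sort_sorted (@le_total _ R) t; rewrite Er => srt.
pose u := [tuple tnth t (r i) | i < N].
have := @sorted_leq_nth _ _ le_trans lexx (Y ord0 i) u srt i j.
rewrite !inE !size_tuple !ltn_ord => /(_ isT isT ij).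
by rewrite -!tnth_nth !tnth_mktuple.
Qed.

Lemma sorting_permP (R : realType) (N : nat) (Y : 'rV[R]_N) :
  sorts Y (sorting_perm Y).
Proof.
rewrite /sorting_perm; case: pickP => [//|H].
by have [r] := sorts_ex Y; rewrite H.
Qed.

Lemma sorts_eq (R : realType) (N : nat) (Y : 'rV[R]_N) (r s : 'S_N) :
  sorts Y r -> sorts Y s -> forall i, Y ord0 (r i) = Y ord0 (s i).
Proof.
move=> hr hs i.
have srt (q : 'S_N) : sorts Y q ->
    sorted <=%O [tuple Y ord0 (q k) | k < N].
  move=> /sortsP hq; apply/(sortedP (Y ord0 i)) => m.
  rewrite size_tuple => mN; have mN' := ltnW mN.
  rewrite -(tnth_nth (Y ord0 i) _ (Ordinal mN)).
  rewrite -(tnth_nth (Y ord0 i) _ (Ordinal mN')) !tnth_mktuple.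
  by apply: hq => /=.
have prm (q : 'S_N) :
    perm_eq [tuple Y ord0 (q k) | k < N] [tuple Y ord0 k | k < N].
  apply/tuple_permP; exists q; congr (tval _).
  by apply: eq_from_tnth => k; rewrite !tnth_mktuple.
have E : [tuple Y ord0 (r k) | k < N] = [tuple Y ord0 (s k) | k < N].
  apply/val_inj/(le_sorted_eq (srt _ hr) (srt _ hs)).
  by rewrite (perm_trans (prm r)) // perm_sym.
by have := congr1 (fun u => tnth u i) E; rewrite !tnth_mktuple.
Qed.

Lemma pl_interpE (R : realType) (N : nat) (a : nat -> R) (k : nat) (t : R) :
  k%:R <= N%:R * t <= k.+1%:R ->
  pl_interp N a t = a k + (N%:R * t - k%:R) * (a k.+1 - a k).
Proof.
move=> /andP[k1]; rewrite le_eqVlt => /predU1P[k2|k2]; last first.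
  by rewrite /pl_interp (@truncn_def _ _ k) // k1.
by rewrite /pl_interp k2 natrK subrr mul0r addr0 -natrB// subSnn mul1r addrC subrK.
Qed.

(* Main.v *)
Require Import Defs.
From mathcomp Require Import all_boot all_order all_algebra all_fingroup.
From mathcomp Require Import all_classical all_reals all_analysis.
From mathcomp Require Import measurable_realfun lra.
Import Order.TTheory GRing.Theory Num.Theory.
Local Open Scope ring_scope.

(** The sum of the [k] smallest entries of [Y] is the maximum over [c] of
    [k c - \sum_i max (0, c - Y_i)]. Each function [y |-> max (0, c - y)] is
    convex, so a transfer [e <= Y_j - Y_i] decreases the subtracted sum and
    therefore raises the nodes of the Lorenz curve. The dual node [k] is the
    (unchanged) total minus the Lorenz node [N - k], so it goes down. Hence the
    difference of the two curves, which is nonnegative, decreases pointwise. *)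

Section PartialSums.
Context {R : realType} {N : nat}.
Implicit Types (Y Z : 'rV[R]_N) (r s : 'S_N).

(** After reindexing the shortfalls by [s], this holds term by term: [c - max 0 (c - y)] is the
    minimum of [c] and [y] for positions below [k], and [- max 0 (c - y)] is at most 0 for the
    others. *)
Lemma shortfall_le_sum Y s (k : nat) (c : R) :
  \sum_(i < N | (i < k)%N) c - \sum_(i < N) Num.max 0 (c - Y ord0 i) <=
  \sum_(i < N | (i < k)%N) Y ord0 (s i).
Proof.
rewrite (reindex_inj (@perm_inj _ s) (P := predT)) /= big_mkcond.
rewrite [leRHS]big_mkcond -sumrB; apply: ler_sum => i _.
by case: ifP => _; rewrite maxEle; case: ifPn; rewrite -?ltNge => ?; lra.
Qed.

Lemma sorts_sum_shortfall Y r (k : nat) : sorts Y r ->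
  exists c : R, \sum_(i < N | (i < k)%N) Y ord0 (r i) =
    \sum_(i < N | (i < k)%N) c - \sum_(i < N) Num.max 0 (c - Y ord0 i).
Proof.
move=> /sortsP Yr; case: N Y r Yr => [|n] Y r Yr.
  by exists 0; rewrite !big_ord0 subrr.
(* The witness is the [k]-th smallest entry, at 0-based position [k - 1]: entries before position
   [k] are at most [c], later ones at least [c]. The minimum handles [k] above the dimension;
   [k = 0] gives the smallest entry, for which all shortfalls vanish. *)
exists (Y ord0 (r (inord (minn k n.+1).-1))).
set c := Y _ _; rewrite [X in _ = _ - X](reindex_inj (@perm_inj _ r)) /=.
rewrite big_mkcond [X in _ = X - _]big_mkcond -sumrB; apply: eq_bigr => i _.
have vE : val (inord (minn k n.+1).-1 : 'I_n.+1) = (minn k n.+1).-1.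
  by rewrite /= inordK//; case: k {c} => [|k]; rewrite ?min0n // minnSS /= ltnS geq_minr.
have i_lt := ltn_ord i.
case: ifPn => [ik|]; last rewrite -leqNgt => ki.
  have : Y ord0 (r i) <= c.
    apply: Yr; rewrite [X in (_ <= X)%N]vE -ltnS prednK ?leq_min ?ik //.
    by case: k ik {c vE} => // k _; rewrite minnSS.
  by move=> yc; rewrite max_r ?subr_ge0//; lra.
have : c <= Y ord0 (r i).
  apply: Yr; rewrite [X in (X <= _)%N]vE (minn_idPl (ltnW (leq_ltn_trans ki i_lt))).
  exact: leq_trans (leq_pred k) ki.
by move=> cy; rewrite max_l ?subr_le0// subr0.
Qed.

(** The [c] that is optimal for [Y] gives a lower bound for [Z]. As [s] need not sort [Z], the case
    [Z = Y] also compares the sorted order with any other order. *)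
Lemma sorts_sum_le Y Z r s (k : nat) : sorts Y r ->
  (forall c : R, \sum_(i < N) Num.max 0 (c - Z ord0 i) <=
     \sum_(i < N) Num.max 0 (c - Y ord0 i)) ->
  \sum_(i < N | (i < k)%N) Y ord0 (r i) <= \sum_(i < N | (i < k)%N) Z ord0 (s i).
Proof.
move=> Yr ZY; have [c ->] := sorts_sum_shortfall Y r k Yr.
by apply: le_trans (shortfall_le_sum Z s k c); rewrite lerB.
Qed.

Lemma sum_rev_ord Y r (k : nat) :
  \sum_(i < N | (i < k)%N) Y ord0 (r (rev_ord i)) =
  \sum_(i < N) Y ord0 i - \sum_(i < N | (i < N - k)%N) Y ord0 (r i).
Proof.
rewrite (reindex_inj (@perm_inj _ r) (P := predT)) /=.
rewrite [X in _ = X - _](bigID (fun i : 'I_N => (i < N - k)%N)) /= addrAC subrr add0r.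
rewrite (reindex_inj rev_ord_inj) /=; apply: eq_big => i; last by rewrite rev_ordK.
by have i_lt := ltn_ord i; rewrite ltn_subLR // -leqNgt leq_subLR addnC addnS ltnS addnC.
Qed.

End PartialSums.

Section PiecewiseLinear.
Context {R : realType} (N : nat).
Implicit Types (a b : nat -> R) (t : R).

Lemma pl_interpB a b t :
  pl_interp N (fun k => a k - b k) t = pl_interp N a t - pl_interp N b t.
Proof. by rewrite /pl_interp; lra. Qed.

(** The value at [t] is a convex combination of nodes [k] and [k.+1], with weights [1 - s] and [s].
    At [t = 1] the cell index is [N], so the formula reads node [N.+1]. *)
Lemma le_pl_interp a b t : 0 <= t <= 1 ->
  (forall k, (k <= N.+1)%N -> a k <= b k) -> pl_interp N a t <= pl_interp N b t.
Proof.
move=> /andP[t0 t1] ab; rewrite /pl_interp.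
have Nt0 : 0 <= N%:R * t by rewrite mulr_ge0.
have /andP[kl ku] := truncn_itv Nt0.
set k := Num.truncn _ in kl ku *.
have kN : (k <= N)%N.
  by rewrite -(ler_nat R) (le_trans kl)// ler_piMr.
have := ab k (leqW kN); have := ab k.+1 kN.
move: ku; rewrite -natr1; set s := N%:R * t - k%:R => ku h1 h0.
have s0 : 0 <= s by rewrite subr_ge0.
have s1 : 0 <= 1 - s by rewrite /s; lra.
have := mulr_ge0 s0 (_ : 0 <= b k.+1 - a k.+1); rewrite subr_ge0 => /(_ h1).
have := mulr_ge0 s1 (_ : 0 <= b k - a k); rewrite subr_ge0 => /(_ h0).
lra.
Qed.

Lemma measurable_pl_interp a : (0 < N)%N ->
  measurable_fun (`[0, 1]%classic : set R) (pl_interp N a).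
Proof.
move=> N0; have NR : 0 < N%:R :> R by rewrite ltr0n.
(* Countably many closed cells cover the interval, and the interpolation is affine on each. *)
pose E k : set R := `[k%:R / N%:R, k.+1%:R / N%:R]%classic.
have mE k : measurable (E k) by exact: measurable_itv.
apply: (@measurable_funS _ _ _ _ (\bigcup_k E k)) => [|t /= |].
- exact: bigcup_measurable.
- rewrite in_itv /= => /andP[t0 _]; exists (Num.truncn (N%:R * t)) => //.
  rewrite /E /= in_itv /= ler_pdivrMr // ler_pdivlMr // [t * _]mulrC.
  have Nt0 : 0 <= N%:R * t by rewrite mulr_ge0.
  by have /andP[-> /ltW ->] := truncn_itv Nt0.
apply/measurable_fun_bigcup => // k.
apply: (@eq_measurable_fun _ _ _ _ _
    (fun t => a k + (N%:R * t - k%:R) * (a k.+1 - a k))).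
  move=> t; rewrite inE /E /= in_itv /= ler_pdivrMr // ler_pdivlMr //.
  by rewrite [t * _]mulrC => kt; rewrite (pl_interpE _ kt).
apply: measurable_funD => //; apply: measurable_funM => //.
by apply: measurable_funB => //; apply: measurable_funM.
Qed.

Lemma integrable_pl_interp_powR (p : R) a : 0 <= p -> (0 < N)%N ->
  (@lebesgue_measure R).-integrable `[0, 1]%classic
    (EFin \o (fun t => `|pl_interp N a t| `^ p)).
Proof.
move=> p0 N0; apply: measurable_bounded_integrable => //=.
- by rewrite lebesgue_measure_itv /= lte_fin ltr01 -EFinB ltry.
- apply: (measurableT_comp (measurable_powR p)).
  by apply: measurableT_comp => //; exact: measurable_pl_interp.
pose M := \sum_(k < N.+2) `|a k|.
have aM k : (k <= N.+1)%N -> `|a k| <= M.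
  move=> kN; rewrite /M (bigD1 (Ordinal (kN : (k < N.+2)%N))) //= lerDl.
  exact: sumr_ge0.
exists (M `^ p); split; first exact: num_real.
move=> x Mx t /= t01; rewrite ger0_norm ?powR_ge0// (le_trans _ (ltW Mx))//.
(* Constants are their own interpolations, so monotonicity in the nodes squeezes the curve between
   [- M] and [M]. *)
have cst (c : R) : pl_interp N (fun=> c) t = c.
  by rewrite /pl_interp subrr mulr0 addr0.
apply: ge0_ler_powR => //; rewrite ?nnegrE//; first exact: sumr_ge0.
rewrite ler_norml -(cst (- M)) -{2}(cst M).
move: t01; rewrite in_itv => t01.
by apply/andP; split; apply: le_pl_interp => // k /aM; rewrite ler_norml => /andP[].
Qed.

End PiecewiseLinear.

Section Transfer.
Context {R : realType} {N : nat}.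
Variables (Y : 'rV[R]_N) (i j : 'I_N) (e : R).
Hypotheses (ij : i != j).

Lemma sum_transfer (f : R -> R) :
  \sum_(k < N) f (transfer i j e Y ord0 k) =
  f (Y ord0 i + e) + (f (Y ord0 j - e) +
    \sum_(k < N | (k != i) && (k != j)) f (Y ord0 k)).
Proof.
rewrite (bigD1 i) //= (bigD1 j) 1?eq_sym //= !mxE eqxx eq_sym (negbTE ij) eqxx.
congr (_ + (_ + _)); apply: eq_bigr => k /andP[ki kj].
by rewrite mxE (negbTE ki) (negbTE kj).
Qed.

Lemma sum_split2 (f : R -> R) :
  \sum_(k < N) f (Y ord0 k) =
  f (Y ord0 i) + (f (Y ord0 j) +
    \sum_(k < N | (k != i) && (k != j)) f (Y ord0 k)).
Proof. by rewrite (bigD1 i) //= (bigD1 j) 1?eq_sym. Qed.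

Lemma total_transfer :
  \sum_(k < N) transfer i j e Y ord0 k = \sum_(k < N) Y ord0 k.
Proof. by rewrite (sum_transfer id) (sum_split2 id) /=; lra. Qed.

Lemma mean_transfer : mean (transfer i j e Y) = mean Y.
Proof. by rewrite /mean total_transfer. Qed.

(** Both new entries lie between the old ones and have the same sum, so convexity of the shortfall
    applies; the proof checks it by cases on the four maxima. *)
Lemma shortfall_transfer (c : R) : 0 <= e <= Y ord0 j - Y ord0 i ->
  \sum_(k < N) Num.max 0 (c - transfer i j e Y ord0 k) <=
  \sum_(k < N) Num.max 0 (c - Y ord0 k).
Proof.
move=> /andP[e0 e1].
rewrite (sum_transfer (fun y => Num.max 0 (c - y))).
rewrite (sum_split2 (fun y => Num.max 0 (c - y))) !addrA lerD2r !maxEle.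
by do 4! [case: ifPn; rewrite -?ltNge => ?]; lra.
Qed.

End Transfer.

Definition lorenz_gap {R : realType} {N : nat} (Y : 'rV[R]_N) (k : nat) : R :=
  \sum_(i < N | (i < k)%N) Y ord0 (sorting_perm Y (rev_ord i)) -
  \sum_(i < N | (i < k)%N) Y ord0 (sorting_perm Y i).

Section LorenzGap.
Context {R : realType} {N : nat}.
Implicit Types Y : 'rV[R]_N.

Lemma dual_lorenzB Y t : dual_lorenz Y t - lorenz Y t = pl_interp N (lorenz_gap Y) t.
Proof. by rewrite -pl_interpB. Qed.

(** The decreasing order is one more permutation of the same entries, and the sorted one minimizes
    partial sums. *)
Lemma lorenz_gap_ge0 Y k : 0 <= lorenz_gap Y k.
Proof.
rewrite subr_ge0.
have -> : \sum_(i < N | (i < k)%N) Y ord0 (sorting_perm Y (rev_ord i)) =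
    \sum_(i < N | (i < k)%N) Y ord0 ((perm rev_ord_inj * sorting_perm Y)%g i).
  by apply: eq_bigr => l _; rewrite permM permE.
by apply: sorts_sum_le => //; exact: sorting_permP.
Qed.

Lemma lorenz_gap_transfer Y (i j : 'I_N) (e : R) k : i != j ->
  0 <= e <= Y ord0 j - Y ord0 i ->
  lorenz_gap (transfer i j e Y) k <= lorenz_gap Y k.
Proof.
move=> ij he; rewrite /lorenz_gap !sum_rev_ord (total_transfer _ _ _ _ ij).
have le l := sorts_sum_le _ _ _ (sorting_perm (transfer i j e Y)) l (sorting_permP Y)
  (fun c => shortfall_transfer _ _ _ _ ij c he).
by rewrite !lerB.
Qed.

End LorenzGap.

Theorem proposition4 (R : realType) (p : R) (hp : 0 < p)
    (N : nat) (Y : 'rV[R]_N) (hY : forall k : 'I_N, 0 < Y ord0 k)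
    (i j : 'I_N) (hij : Y ord0 i < Y ord0 j) :
  exists ebar : R, 0 < ebar /\
    forall e : R, 0 <= e <= ebar ->
      S_index p (transfer i j e Y) <= S_index p Y.
Proof.
(* At this bound the transfer exactly swaps the two entries. *)
exists (Y ord0 j - Y ord0 i); split=> [|e he]; first by rewrite subr_gt0.
have ij : i != j by apply: contraTneq hij => ->; rewrite ltxx.
have N0 : (0 < N)%N by exact: leq_ltn_trans (ltn_ord i).
rewrite /S_index (mean_transfer _ _ _ _ ij); apply: ler_wpM2l.
  rewrite invr_ge0 mulr_ge0// /mean mulr_ge0 ?invr_ge0//.
  by apply: sumr_ge0 => k _; exact/ltW.
apply: ge0_ler_powR.
- by rewrite invr_ge0 ltW.
- by rewrite nnegrE; apply: Rintegral_ge0 => t _; exact: powR_ge0.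
- by rewrite nnegrE; apply: Rintegral_ge0 => t _; exact: powR_ge0.
under eq_Rintegral do rewrite dual_lorenzB.
under [leRHS]eq_Rintegral do rewrite dual_lorenzB.
apply: le_Rintegral.
- exact: measurable_itv.
- exact: integrable_pl_interp_powR (ltW hp) N0.
- exact: integrable_pl_interp_powR (ltW hp) N0.
move=> t /=; rewrite in_itv /= => t01.
(* Nonnegativity removes the absolute values, so comparing nodes suffices. *)
have pl0 Z : 0 <= pl_interp N (@lorenz_gap R N Z) t.
  have -> : 0 = pl_interp N (fun=> 0) t :> R by rewrite /pl_interp subrr mulr0 addr0.
  by apply: le_pl_interp => // k _; exact: lorenz_gap_ge0.
apply: ge0_ler_powR; rewrite ?nnegrE ?(ltW hp)// !ger0_norm//.
by apply: le_pl_interp => // k _; exact: lorenz_gap_transfer.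
Qed.
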